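(* Let $A^5_{21}$, $B^5_{21}$, $B^5_{26}$, $A^5_{41}$ be the pure $5$-dimensional simplicial complexes specified in the context, and let $M^4_{21}=\partial A^5_{21}$, $N^4_{21}=\partial B^5_{21}$, $N^4_{26}=\partial B^5_{26}$, $M^4_{41}=\partial A^5_{41}$. Then (a) $A^5_{21}, B^5_{21}, B^5_{26}, A^5_{41}\in\overline{\mathcal K}(5)$; (b) $\mathrm{Aut}(A^5_{21})=\mathrm{Aut}(M^4_{21})=\mathbb{Z}_7$ and $\mathrm{Aut}(B^5_{21})=\mathrm{Aut}(N^4_{21})=\mathbb{Z}_7$; (c) $\mathrm{Aut}(B^5_{26})=\mathrm{Aut}(N^4_{26})=\mathbb{Z}_{13}$; (d) $\mathrm{Aut}(A^5_{41})=\mathrm{Aut}(M^4_{41})=\mathbb{Z}_{41}$. (Here each $\mathbb{Z}_m$ is the cyclic group acting on the vertex set as described in the context.)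
   Context: All simplicial complexes are finite and abstract. A simplicial complex is pure if all its maximal faces (facets) have the same dimension. For a pure $d$-dimensional complex $X$ in which each $(d-1)$-face lies in at most two facets (a weak pseudomanifold), the boundary $\partial X$ is the pure $(d-1)$-dimensional subcomplex whose facets are the $(d-1)$-faces of $X$ contained in exactly one facet of $X$. $\mathrm{Aut}(X)$ is the group of permutations of the vertex set of $X$ that map faces to faces. For a simplex $\sigma$, $\overline{\sigma}$ denotes the complex consisting of $\sigma$ and all its faces. A stacked $d$-ball is a pure $d$-dimensional simplicial complex $X$ for which there is a sequence $B_1,\dots,B_m$ of pure simplicial complexes such that $B_1$ is a standard $d$-ball (a pure $d$-dimensional complex with a single facet), $B_m=X$, and for $2\le i\le m$, $B_i=B_{i-1}\cup\overline{\sigma_i}$ and $B_{i-1}\cap\overline{\sigma_i}=\overline{\tau_i}$, where $\sigma_i$ is a $d$-face and $\tau_i$ is a $(d-1)$-face of $\sigma_i$. $\overline{\mathcal K}(d)$ is the class of all $d$-dimensional simplicial complexes all of whose vertex links are stacked $(d-1)$-balls. The complexes (a facet is written as the string of its vertices; the list of all facets is the union of the orbits of the listed basic facets under the stated group): $A^5_{21}$: vertex set $V_{21}=\bigcup_{i=0}^{6}\{a_i,b_i,c_i\}$ ($21$ elements), with $\mathbb{Z}_7$ acting by $i\cdot a_j=a_{i+j}$, $i\cdot b_j=b_{i+j}$, $i\cdot c_j=c_{i+j}$ (indices modulo $7$). Basic facets: $a_0a_1a_2b_0b_1c_0$, $a_1a_2b_0b_1b_2c_0$, $a_1a_2a_3b_0b_1b_2$,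 $a_0a_1b_0b_1c_0c_3$, $a_0a_1b_0b_3c_0c_3$, $a_0b_0b_3c_0c_3c_4$, $a_0a_3b_3c_0c_3c_4$, $a_3b_3c_0c_3c_4c_6$ ($56$ facets in all). $B^5_{21}$: same vertex set $V_{21}$ and same $\mathbb{Z}_7$-action. Basic facets: $a_0a_1a_2b_0b_1c_0$, $a_0a_1a_2b_1b_2c_0$, $a_0a_1a_2a_3b_1b_2$, $a_0a_1b_0b_1c_0c_3$, $a_0b_0b_1b_3c_0c_3$, $a_0b_0b_3c_0c_3c_4$, $a_3b_0b_3c_0c_3c_4$, $a_3b_3c_0c_3c_4c_6$. $B^5_{26}$: vertex set $V_{26}=\bigcup_{i=0}^{12}\{a_i,b_i\}$ ($26$ elements), with $\mathbb{Z}_{13}$ acting by $i\cdot a_j=a_{i+j}$, $i\cdot b_j=b_{i+j}$ (indices modulo $13$). Basic facets: $a_0a_{10}a_{11}a_{12}b_9b_{10}$, $a_0a_1a_{10}a_{11}a_{12}b_{10}$, $a_0a_{11}a_{12}b_5b_9b_{10}$, $a_0a_{11}a_{12}b_2b_5b_{10}$, $a_0a_7a_{12}b_2b_5b_{10}$, $a_7a_{12}b_0b_2b_5b_{10}$, $a_7b_0b_2b_5b_8b_{10}$ ($91$ facets in all). $A^5_{41}$: vertex set $V_{41}=\{a_0,a_1,\dots,a_{40}\}$ ($41$ elements), with $\mathbb{Z}_{41}$ acting by $i\cdot a_j=a_{i+j}$ (indices modulo $41$). Basic facets: $a_{36}a_{37}a_{38}a_{39}a_{40}a_0$, $a_{36}a_{37}a_{38}a_{39}a_0a_6$,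 $a_{37}a_{38}a_{39}a_0a_6a_{13}$, $a_{38}a_{39}a_0a_6a_{13}a_{20}$, $a_{39}a_0a_6a_{13}a_{20}a_{27}$, $a_6a_{13}a_{20}a_{27}a_{34}a_0$ ($246$ facets in all). *)

(* Defs.v *)
From HB Require Import structures.
From mathcomp Require Import all_boot all_fingroup all_algebra.

Set Implicit Arguments.
Unset Strict Implicit.
Unset Printing Implicit Defensive.

Section Complexes.
Variable T : finType.
Implicit Types (X B : {set {set T}}) (s t f : {set T}) (v : T) (d : nat).

(* The empty set is a face, of dimension -1; a d-face has d.+1 elements.      *)
(* A complex need not use all the points of T: its vertices are [vertices X]. *)
Definition is_complex X : bool :=
  (set0 \in X) && [forall s in X, forall t : {set T}, (t \subset s) ==> (t \in X)].

Definition vertices X : {set T} := [set v : T | [set v] \in X].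

Definition facets X : {set {set T}} := [set s | maxset (fun u => u \in X) s].

Definition has_dim d X : bool := \max_(s in X) #|s| == d.+1.

Definition pure d X : bool :=
  is_complex X && [forall s in facets X, #|s| == d.+1].

Definition spanned_complex (F : {set {set T}}) : {set {set T}} :=
  [set s : {set T} | [exists f in F, s \subset f]].

(* Meant for a pure d-dimensional weak pseudomanifold X. *)
Definition boundary d X : {set {set T}} :=
  spanned_complex [set t in X | (#|t| == d) &&
                          (#|[set f in facets X | t \subset f]| == 1%N)].

Definition link X v : {set {set T}} := [set s : {set T} | (v \notin s) && (v |: s \in X)].

Definition standard_ball d B : bool := pure d B && (#|facets B| == 1%N).

Definition stacking_step d B B' : Prop :=
  exists s t : {set T},
    [/\ #|s| = d.+1, #|t| = d, t \subset s,
        B' = B :|: powerset s & B :&: powerset s = powerset t].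

Definition stacked_ball d X : Prop :=
  pure d X /\
  exists (m : nat) (B : nat -> {set {set T}}),
    [/\ (1 <= m)%N,
        forall i, (1 <= i <= m)%N -> pure d (B i),
        standard_ball d (B 1%N),
        B m = X
      & forall i, (2 <= i <= m)%N -> stacking_step d (B i.-1) (B i)].

(* Meant for d > 0. *)
Definition Kbar d X : Prop :=
  [/\ is_complex X, has_dim d X
    & forall v, v \in vertices X -> stacked_ball d.-1 (link X v)].

Definition AutC X : {set {perm T}} :=
  [set p : {perm T} | perm_on (vertices X) p && [forall s in X, p @: s \in X]].

Lemma AutC_group_set X : group_set (AutC X).
Proof.
apply/group_setP; split=> [|p q].
  rewrite inE perm_on1; apply/forall_inP => s sX.
  by rewrite (eq_imset _ (@perm1 T)) imset_id.
rewrite !inE => /andP[pV /forall_inP pX] /andP[qV /forall_inP qX].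
rewrite perm_onM //; apply/forall_inP => s sX.
by rewrite (eq_imset _ (permM p q)) (imset_comp q p) qX ?pX.
Qed.

Canonical AutC_group X := Group (AutC_group_set X).

End Complexes.

(* k families of m vertices; 'Z_m (additive group, m > 1) shifts the indices. *)
Section Cyclic.
Variables k m : nat.

Definition vert : finType := ('I_k * 'Z_m)%type.

Definition shift (x : vert) (i : 'Z_m) : vert := (x.1, (i + x.2)%R).

Lemma shift_is_action : is_action [set: 'Z_m] shift.
Proof.
apply: is_total_action => [[l j]|[l j] i i']; rewrite /shift /=.
  by rewrite GRing.add0r.
by rewrite GRing.addrA [(i' + i)%R]GRing.addrC.
Qed.

Canonical shift_action := Action shift_is_action.

Definition cyclic_complex (basic : seq (seq vert)) : {set {set vert}} :=
  spanned_complex (\bigcup_(w <- basic) orbit (shift_action^*)%act [set: 'Z_m] [set:: w]).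

End Cyclic.

Definition va k m (i : nat) : vert k.+1 m := (@Ordinal k.+1 0 isT, inZp i).
Definition vb k m (i : nat) : vert k.+2 m := (@Ordinal k.+2 1 isT, inZp i).
Definition vc k m (i : nat) : vert k.+3 m := (@Ordinal k.+3 2 isT, inZp i).

Definition A21 : {set {set vert 3 7}} :=
  let a := va 2 7 in let b := vb 1 7 in let c := vc 0 7 in
  cyclic_complex
    [:: [:: a 0; a 1; a 2; b 0; b 1; c 0];
        [:: a 1; a 2; b 0; b 1; b 2; c 0];
        [:: a 1; a 2; a 3; b 0; b 1; b 2];
        [:: a 0; a 1; b 0; b 1; c 0; c 3];
        [:: a 0; a 1; b 0; b 3; c 0; c 3];
        [:: a 0; b 0; b 3; c 0; c 3; c 4];
        [:: a 0; a 3; b 3; c 0; c 3; c 4];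
        [:: a 3; b 3; c 0; c 3; c 4; c 6]]%N.

Definition B21 : {set {set vert 3 7}} :=
  let a := va 2 7 in let b := vb 1 7 in let c := vc 0 7 in
  cyclic_complex
    [:: [:: a 0; a 1; a 2; b 0; b 1; c 0];
        [:: a 0; a 1; a 2; b 1; b 2; c 0];
        [:: a 0; a 1; a 2; a 3; b 1; b 2];
        [:: a 0; a 1; b 0; b 1; c 0; c 3];
        [:: a 0; b 0; b 1; b 3; c 0; c 3];
        [:: a 0; b 0; b 3; c 0; c 3; c 4];
        [:: a 3; b 0; b 3; c 0; c 3; c 4];
        [:: a 3; b 3; c 0; c 3; c 4; c 6]]%N.

Definition B26 : {set {set vert 2 13}} :=
  let a := va 1 13 in let b := vb 0 13 in
  cyclic_complex
    [:: [:: a 0; a 10; a 11; a 12; b 9; b 10];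
        [:: a 0; a 1; a 10; a 11; a 12; b 10];
        [:: a 0; a 11; a 12; b 5; b 9; b 10];
        [:: a 0; a 11; a 12; b 2; b 5; b 10];
        [:: a 0; a 7; a 12; b 2; b 5; b 10];
        [:: a 7; a 12; b 0; b 2; b 5; b 10];
        [:: a 7; b 0; b 2; b 5; b 8; b 10]]%N.

Definition A41 : {set {set vert 1 41}} :=
  let a := va 0 41 in
  cyclic_complex
    [:: [:: a 36; a 37; a 38; a 39; a 40; a 0];
        [:: a 36; a 37; a 38; a 39; a 0; a 6];
        [:: a 37; a 38; a 39; a 0; a 6; a 13];
        [:: a 38; a 39; a 0; a 6; a 13; a 20];
        [:: a 39; a 0; a 6; a 13; a 20; a 27];
        [:: a 6; a 13; a 20; a 27; a 34; a 0]]%N.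

Definition M21 := boundary 5 A21.
Definition N21 := boundary 5 B21.
Definition N26 := boundary 5 B26.
Definition M41 := boundary 5 A41.

(* The permutation representation of 'Z_m is injective with image exactly     *)
(* AutC X: the group is 'Z_m acting as prescribed, not just abstractly.       *)
Definition Aut_is_shift k m (X : {set {set vert k m}}) : Prop :=
  isom [set: 'Z_m] (AutC X) (actperm (shift_action k m)).

(* Main.v *)
Require Import Defs.
From mathcomp Require Import all_boot all_fingroup all_algebra.

Set Implicit Arguments.
Unset Strict Implicit.
Unset Printing Implicit Defensive.

(** Three observations reduce the statement to a short computation.

    A complex given by a list of facets is stacked along that list as soon as
    each facet brings one new vertex and its opposite face already lies in an
    earlier facet: the new vertex forces the intersection with the earlier
    facets into that opposite face. By the cyclic symmetry only the link of one
    vertex in each family has to be stacked in this way, and this gives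
    membership in [Kbar] ([Kbar_span]).

    In a stacked ball, a face of codimension at least 2 lies on the boundary:
    this persists when a simplex is glued along a ridge, because a face of
    codimension 2 of the simplex lies in a second ridge, which is free. Applied
    in the vertex links, it shows that a complex X in [Kbar] and its boundary
    have the same nonempty faces with at most d elements when the facets of X
    have d + 2 of them ([boundary_small_face]). With d = 4, an automorphism of X
    or of its boundary therefore preserves the faces of X with at most 4
    vertices, and so the number of vertices in the star of each set of at
    most 3 vertices.

    These star sizes are enough to pin an automorphism down. After composition
    with a rotation it sends a chosen vertex x0 to the vertex of index 0 in some
    family. For a suitable base of three vertices starting with x0, the star
    sizes leave only one possible image of the base, namely itself, and the
    star sizes relative to the base tell all the vertices apart; so the
    automorphism is the identity ([rigid_baseP]). This settles X and its
    boundary at once, and [cyclic_certificate] collects what is left to compute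
    for each of the four complexes. *)

(** * Complexes spanned by lists of facets *)

Section Span.
Variable T : finType.
Implicit Types (ws : seq (seq T)) (w : seq T) (s t f : {set T}) (p : {perm T}).

(** Facets are kept as lists so that everything below can be computed; only
    the resulting complex is a set of sets. *)
Definition span ws : {set {set T}} := [set s : {set T} | has (fun w => s \subset [set:: w]) ws].

Definition facet_words d ws := all (fun w => uniq w && (size w == d.+1)) ws.

Lemma card_word w : uniq w -> #|[set:: w]| = size w.
Proof. by move=> /card_uniqP <-; apply: eq_card => x; rewrite inE. Qed.

Lemma span_card d ws s : facet_words d ws -> s \in span ws -> #|s| <= d.+1.
Proof.
move=> /allP wd; rewrite inE => /hasP[w /wd /andP[_ /eqP <-] sw].
by apply: leq_trans (subset_leq_card sw) _; rewrite cardsE card_size.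
Qed.

Lemma word_in_span ws w : w \in ws -> [set:: w] \in span ws.
Proof. by move=> wws; rewrite inE; apply/hasP; exists w. Qed.

Lemma span_complex ws : ws != [::] -> is_complex (span ws).
Proof.
case: ws => // w ws _; apply/andP; split.
  by rewrite inE /= sub0set.
apply/forall_inP => s; rewrite inE => /hasP[g gws sg].
apply/forallP => t; apply/implyP => ts; rewrite inE; apply/hasP; exists g => //.
exact: subset_trans sg.
Qed.

Lemma span_pure d ws : ws != [::] -> facet_words d ws -> pure d (span ws).
Proof.
move=> ws0 wd; rewrite /pure span_complex //=.
apply/forall_inP => s; rewrite inE => /maxsetP[]; rewrite inE => /hasP[w wws sw] smax.
have /andP[wu /eqP ws_] := allP wd _ wws.
by rewrite -(smax [set:: w]) ?card_word ?ws_ // word_in_span.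
Qed.

Lemma span_dim d ws : ws != [::] -> facet_words d ws -> has_dim d (span ws).
Proof.
move=> ws0 wd; rewrite /has_dim eqn_leq; apply/andP; split.
  by apply/bigmax_leqP => s; apply: span_card.
case: ws ws0 wd => // w ws _ /= /andP[/andP[wu /eqP <-] _].
by rewrite -card_word //; apply: leq_bigmax_cond; apply: word_in_span; rewrite inE eqxx.
Qed.

Lemma eq_span ws1 ws2 : ws1 =i ws2 -> span ws1 = span ws2.
Proof. by move=> e; apply/setP => s; rewrite !inE; apply: eq_has_r. Qed.

(** * Stacking a ball facet by facet *)

(** A facet w meets the earlier facets ws exactly in the face opposite to x:
    at most that face because x is new, at least that face because a single
    facet g contains it. *)
Definition attaches w ws :=
  has (fun x => all (fun g => x \notin g) ws &&
                has (fun g => all (mem g) [seq y <- w | y != x]) ws) w.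

(** The head of the list is the facet glued last. *)
Fixpoint stacking ws :=
  if ws is w :: ws' then (ws' == [::]) || attaches w ws' && stacking ws' else false.

Lemma span1_facets w : facets (span [:: w]) = [set [set:: w]].
Proof.
apply/setP => s; rewrite !inE; apply/idP/eqP => [/maxsetP[]|->].
  rewrite inE /= orbF => sw smax; apply/esym/smax; first by rewrite word_in_span ?inE.
  exact: sw.
apply/maxsetP; split=> [|t]; first by rewrite word_in_span ?inE.
by rewrite inE /= orbF => tw wt; apply/eqP; rewrite eqEsubset wt tw.
Qed.

Lemma attaches_step d w ws : facet_words d (w :: ws) -> attaches w ws ->
  stacking_step d (span ws) (span (w :: ws)).
Proof.
move=> /= /andP[/andP[wu /eqP wsz] _] /hasP[x xw /andP[/allP xnew /hasP[g gws /allP wg]]].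
exists [set:: w], ([set:: w] :\ x).
have xw' : x \in [set:: w] by rewrite inE.
split.
- by rewrite card_word.
- by have := cardsD1 x [set:: w]; rewrite xw' card_word // wsz => -[].
- exact: subsetDl.
- by apply/setP => s; rewrite !inE /= orbC.
apply/setP => s; rewrite !inE; apply/andP/idP => [[/hasP[h hws sh] sw]|sw].
  rewrite subsetD1 sw; by apply: contra (xnew _ hws) => /(subsetP sh); rewrite inE.
split; last by apply: subset_trans sw (subsetDl _ _).
apply/hasP; exists g => //; apply/subsetP => y /(subsetP sw).
by rewrite !inE => /andP[yx yw]; apply: (wg y); rewrite mem_filter yx.
Qed.

Lemma facet_words_drop d ws n : facet_words d ws -> facet_words d (drop n ws).
Proof. by move/allP=> wd; apply/allP => w /mem_drop /wd. Qed.

Lemma stacking_drop ws n : n < size ws -> stacking ws -> stacking (drop n ws).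
Proof.
elim: ws n => [|w ws IH] [|n] //= nws /orP[/eqP ws0|/andP[_ /IH]]; last exact.
by rewrite ws0 in nws.
Qed.

(** The final segments of the list span the successive balls. *)
Lemma stacking_ball d ws : facet_words d ws -> stacking ws -> stacked_ball d (span ws).
Proof.
move=> wd st; have ws0 : ws != [::] by case: (ws) st.
have ne i : 1 <= i <= size ws -> drop (size ws - i) ws != [::].
  case/andP=> i0 im; rewrite -size_eq0 size_drop subKn //; by case: i i0 {im}.
split; first exact: span_pure.
exists (size ws), (fun i => span (drop (size ws - i) ws)); split.
- by rewrite lt0n size_eq0.
- move=> i im; apply: span_pure; [exact: ne|exact: facet_words_drop].
- have m0 : 0 < size ws by rewrite lt0n size_eq0.
  have : size (drop (size ws - 1) ws) = 1%N by rewrite size_drop subKn.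
  have := facet_words_drop (size ws - 1) wd.
  case: (drop _ ws) => [|w [|? ?]] // wd1 _; apply/andP; split; first exact: span_pure.
  by rewrite span1_facets cards1.
- by rewrite subnn drop0.
move=> [|i] //= /andP[i2 im].
have lt : size ws - i.+1 < size ws by rewrite ltn_subrL (leq_trans _ im).
have e : drop (size ws - i) ws = behead (drop (size ws - i.+1) ws).
  by rewrite -drop1 drop_drop add1n -subSn // subSS.
have ne' : drop (size ws - i) ws != [::] by apply: ne; rewrite -ltnS i2 ltnW.
have := stacking_drop lt st; have := facet_words_drop (size ws - i.+1) wd.
rewrite e in ne' *; case: (drop _ ws) ne' => [|w ws'] //= ws0' wd' /orP[/eqP e0|/andP[att _]].
  by rewrite e0 in ws0'.
exact: attaches_step.
Qed.

Definition stack_step (br : seq (seq T) * seq (seq T)) :=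
  let i := find (attaches^~ br.1) br.2 in
  (take 1 (drop i br.2) ++ br.1, take i br.2 ++ drop i.+1 br.2).

(** A greedy search for a stacking order. Nothing is claimed about its result,
    since [stacked_link] tests whether it is a stacking of the given facets. *)
Definition stack_order ws := (iter (size ws) stack_step (take 1 ws, drop 1 ws)).1.

(** * Vertex links *)

Definition link_words ws v := [seq [seq x <- w | x != v] | w <- [seq w <- ws | v \in w]].

Lemma link_span ws v : link (span ws) v = span (link_words ws v).
Proof.
apply/setP => s; rewrite !inE has_map.
apply/andP/hasP => [[vs /hasP[w wws]]|[w]].
  rewrite subUset sub1set inE => /andP[vw sw]; exists w; first by rewrite mem_filter vw.
  apply/subsetP => x xs; have := subsetP sw _ xs; rewrite !inE mem_filter => ->.
  rewrite andbT; by apply: contraNneq vs => <-.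
rewrite mem_filter => /andP[vw wws] /= sw.
split; first by apply/negP => /(subsetP sw); rewrite inE mem_filter eqxx.
apply/hasP; exists w => //; rewrite subUset sub1set inE vw.
by apply/subsetP => x /(subsetP sw); rewrite !inE mem_filter => /andP[].
Qed.

Lemma facet_words_link d ws v : facet_words d.+1 ws -> facet_words d (link_words ws v).
Proof.
move=> /allP wd; rewrite /facet_words all_map; apply/allP => w.
rewrite mem_filter => /andP[vw /wd /andP[wu /eqP sw]] /=.
rewrite filter_uniq //= size_filter -(eqn_add2l (count (pred1 v) w)).
by rewrite (count_predC (pred1 v)) count_uniq_mem // vw sw.
Qed.

(** * Transport of stackings by automorphisms *)

Lemma AutC_mem (X : {set {set T}}) p s : p \in AutC X -> (p @: s \in X) = (s \in X).
Proof.
move=> pX; have aux q t : q \in AutC X -> t \in X -> q @: t \in X.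
  by rewrite inE => /andP[_ /forall_inP]; apply.
apply/idP/idP => [|/(aux p)]; last exact.
have pX' : (p^-1)%g \in AutC X by rewrite groupV.
move/(aux _ _ pX'); rewrite -imset_comp (eq_imset (g := id)) ?imset_id // => x.
by rewrite /= permK.
Qed.

Lemma imset_permKV p s : p @: ((p^-1)%g @: s) = s.
Proof.
by rewrite -imset_comp (eq_imset (g := id)) ?imset_id // => x /=; rewrite permKV.
Qed.

Lemma span_map p ws : p \in AutC (span ws) -> span (map (map p) ws) = span ws.
Proof.
move=> pX; apply/setP => s; rewrite -(imset_permKV p s) (AutC_mem _ pX).
move: ((p^-1)%g @: s) => {}s; rewrite !inE has_map; apply: eq_has => w /=.
apply/subsetP/subsetP => sub x xs.
  by have := sub _ (imset_f p xs); rewrite !inE mem_map //; apply: perm_inj.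
by case/imsetP: xs => y /sub; rewrite !inE => yw ->; apply: map_f.
Qed.

Lemma link_words_map p ws v :
  link_words (map (map p) ws) (p v) = map (map p) (link_words ws v).
Proof.
rewrite /link_words filter_map -!map_comp.
rewrite (eq_filter (a2 := fun w => v \in w)); last first.
  by move=> w /=; rewrite mem_map //; apply: perm_inj.
apply: eq_map => w /=; rewrite filter_map; congr map.
by apply: eq_filter => x /=; rewrite (inj_eq perm_inj).
Qed.

Lemma attaches_map p w ws : attaches (map p w) (map (map p) ws) = attaches w ws.
Proof.
rewrite /attaches has_map; apply: eq_has => x /=; rewrite all_map has_map.
congr (_ && _).
  by apply: eq_all => g /=; rewrite mem_map //; apply: perm_inj.
apply: eq_has => g /=; rewrite filter_map all_map.
rewrite (eq_filter (a2 := fun y => y != x)); last first.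
  by move=> y /=; rewrite (inj_eq perm_inj).
by apply: eq_all => y /=; rewrite mem_map //; apply: perm_inj.
Qed.

Lemma stacking_map p ws : stacking (map (map p) ws) = stacking ws.
Proof. by elim: ws => //= w ws ->; rewrite attaches_map; case: ws. Qed.

Lemma facet_words_map d p ws : facet_words d (map (map p) ws) = facet_words d ws.
Proof.
rewrite /facet_words all_map; apply: eq_all => w /=.
by rewrite map_inj_uniq ?size_map //; apply: perm_inj.
Qed.

Definition stacked_link ws v :=
  let L := link_words ws v in let S := stack_order L in stacking S && perm_eq S L.

(** One computation serves the whole orbit of v: the link of its image under p
    is spanned by the image of the list of facets, which is stacked in the same
    order. *)
Lemma stacked_linkP d ws v : facet_words d.+1 ws -> stacked_link ws v ->
  forall p, p \in AutC (span ws) -> stacked_ball d (link (span ws) (p v)).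
Proof.
move=> wd /andP[st /perm_mem pe] p pX.
set S := stack_order _ in st pe.
rewrite -(span_map pX) link_span link_words_map.
rewrite (eq_span (ws2 := map (map p) S)); last exact/eq_mem_map/fsym.
apply: stacking_ball; last by rewrite stacking_map.
rewrite facet_words_map /facet_words (eq_all_r pe); exact: facet_words_link.
Qed.

Lemma Kbar_span d ws (reps : seq T) : ws != [::] -> facet_words d.+1 ws ->
  (forall v, exists2 p, p \in AutC (span ws) & p v \in reps) ->
  all (stacked_link ws) reps -> Kbar d.+1 (span ws).
Proof.
move=> ws0 wd tr /allP lk; split; [exact: span_complex|exact: span_dim|].
move=> v _; have [p pX /lk vr] := tr v; rewrite -[v](permK p).
by apply: stacked_linkP; rewrite ?groupV.
Qed.

End Span.

(** * Small faces lie on the boundary *)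

Section Boundary.
Variable T : finType.
Implicit Types (X B : {set {set T}}) (s t u f : {set T}) (p : {perm T}) (d : nat).

Lemma complex_sub X s t : is_complex X -> s \in X -> t \subset s -> t \in X.
Proof. by case/andP=> _ /forall_inP/(_ s) H /H /forallP/(_ t)/implyP; apply. Qed.

(** Faces with d.+1 elements replace facets here because they are easier to
    track when a simplex is glued to B; in a pure complex they are the same. *)
Definition boundary_ridge d B t :=
  #|t| = d /\ exists f, [/\ t \subset f, f \in B, #|f| = d.+1 &
                         forall g, g \in B -> #|g| = d.+1 -> t \subset g -> g = f].

Definition small_faces_on_boundary d B :=
  forall u, u \in B -> #|u| < d -> exists2 t, boundary_ridge d B t & u \subset t.

Lemma standard_ball_small_faces d B : standard_ball d B -> small_faces_on_boundary d B.
Proof.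
case/andP=> /andP[cB /forall_inP pB] /cards1P[s eB] u uB ud.
have in_s g : g \in B -> g \subset s.
  move=> gB; have [h hmax gh] := maxset_exists (P := fun x => x \in B) gB.
  have : h \in facets B by rewrite inE.
  by rewrite eB inE => /eqP <-.
have sF : s \in facets B by rewrite eB inE.
have sB : s \in B by move: sF; rewrite inE => /maxsetp.
have /eqP cs := pB s sF.
have us := in_s u uB.
have /card_gt0P[x] : 0 < #|s :\: u|.
  by rewrite cardsDS // subn_gt0 cs (leq_trans ud).
rewrite inE => /andP[xu xs]; exists (s :\ x); last by rewrite subsetD1 us.
split; first by move: cs; rewrite (cardsD1 x s) xs => -[].
exists s; split=> // [|g gB gd _]; first exact: subsetDl.
by apply/eqP; rewrite eqEcard in_s //= gd cs.
Qed.

(** Faces outside the new simplex s keep their boundary ridge, as that ridge is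
    not in s either. A face u of s is too small to contain the gluing ridge r;
    a vertex x in r but not in u is opposite to a ridge of s that contains u, and
    this ridge is different from r, hence free. *)
Lemma stacking_step_small_faces d B B' : is_complex B ->
  stacking_step d B B' -> small_faces_on_boundary d B -> small_faces_on_boundary d B'.
Proof.
move=> cB [s [r [cs cr rs -> eBr]]] IH u uB' ud.
have meet g : g \in B -> g \subset s -> g \subset r.
  by move=> gB gs; rewrite -powersetE -eBr inE gB powersetE.
have [us|us] := boolP (u \subset s); last first.
  have uB : u \in B by move: uB'; rewrite inE powersetE (negbTE us) orbF.
  have [t [ct [f [tf fB cf fu]]] ut] := IH u uB ud; exists t => //; split=> //.
  exists f; split=> // [|g]; first by rewrite inE fB.
  rewrite inE powersetE => /orP[gB|gs _ tg]; first exact: fu.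
  by case/negP: us; apply: subset_trans ut (subset_trans tg gs).
have /subsetPn[x xr xu] : ~~ (r \subset u).
  by apply/negP => /subset_leq_card; rewrite cr leqNgt ud.
have xs := subsetP rs _ xr.
have ct : #|s :\ x| = d by move: cs; rewrite (cardsD1 x s) xs => -[].
exists (s :\ x); last by rewrite subsetD1 us.
split=> //; exists s; split=> // [||g].
- exact: subsetDl.
- by rewrite inE powersetE subxx orbT.
rewrite inE powersetE => /orP[gB _ tg|gs cg _]; last first.
  by apply/eqP; rewrite eqEcard gs cg cs /=.
have /meet/(_ (subsetDl _ _)) : s :\ x \in B by apply: complex_sub tg.
move=> tr; have /eqP e : s :\ x == r by rewrite eqEcard tr cr ct /=.
by move: xr; rewrite -e !inE eqxx.
Qed.

Lemma stacked_ball_small_faces d B : stacked_ball d B -> small_faces_on_boundary d B.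
Proof.
case=> _ [m [C [m1 pC C1 <- Cs]]].
suff H i : 0 < i <= m -> small_faces_on_boundary d (C i) by apply: H; rewrite m1 /=.
elim: i => [|[_ _|i IH /andP[_ im]]] //; first exact: standard_ball_small_faces.
apply: stacking_step_small_faces (Cs i.+2 im) (IH (ltnW im)).
by have /andP[] := pC i.+1 (ltnW im).
Qed.

(** A boundary ridge of the link of v becomes, with v added, a boundary ridge
    of X: the facets around it correspond to those around the ridge in the
    link. *)
Lemma boundary_small_face d X s : pure d.+1 X -> Kbar d.+1 X ->
  s \in X -> s != set0 -> #|s| <= d -> s \in boundary d.+1 X.
Proof.
case/andP=> cX /forall_inP pX [_ _ lkX] sX /set0Pn[v vs] sd.
have vX : v \in vertices X by rewrite inE (complex_sub cX sX) ?sub1set.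
have uL : s :\ v \in link X v by rewrite inE !inE eqxx setD1K.
have cs : #|s| = #|s :\ v|.+1 by rewrite (cardsD1 v s) vs.
have [|t [ct [f [tf]]]] := stacked_ball_small_faces (lkX v vX) uL.
  by rewrite /= -ltnS -cs.
rewrite inE => /andP[vf fX] cf fu ut; rewrite /= in ct cf fu.
have vt : v \notin t by apply: contra vf; apply: (subsetP tf).
rewrite inE; apply/exists_inP; exists (v |: t); last by rewrite -(setD1K vs) setUS.
have cvt : #|v |: t| = d.+1 by rewrite cardsU1 vt ct.
rewrite inE cvt eqxx (complex_sub cX fX) ?setUS //=; apply/cards1P; exists (v |: f).
have max g : g \in X -> exists2 h, h \in facets X & g \subset h.
  move=> gX; have [h hmax gh] := maxset_exists (P := fun x => x \in X) gX.
  by exists h; rewrite ?inE.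
have fF : v |: f \in facets X.
  have [h hF fh] := max _ fX; suff -> : v |: f = h by [].
  by apply/eqP; rewrite eqEcard fh (eqP (pX _ hF)) cardsU1 vf cf /=.
apply/setP => g; rewrite in_set in_set1.
apply/andP/eqP => [[gF]|->]; last by rewrite fF setUS.
rewrite subUset sub1set => /andP[vg tg].
have gX : g \in X by move: gF; rewrite inE => /maxsetp.
have cg : #|g| = d.+2 by apply/eqP; apply: pX.
rewrite -(setD1K vg); congr (_ |: _); apply: fu.
- by rewrite inE !inE eqxx setD1K.
- by move: cg; rewrite (cardsD1 v g) vg => -[].
by rewrite subsetD1 tg.
Qed.

Lemma boundary_sub d X : is_complex X -> boundary d X \subset X.
Proof.
move=> cX; apply/subsetP => s; rewrite inE => /exists_inP[t]; rewrite inE => /andP[tX _].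
exact: complex_sub tX.
Qed.

Lemma boundary_vertices d X : pure d.+2 X -> Kbar d.+2 X ->
  vertices (boundary d.+2 X) = vertices X.
Proof.
move=> pX kX; have cX : is_complex X by case/andP: pX.
apply/setP => v; rewrite in_set [RHS]in_set.
apply/idP/idP; first exact: (subsetP (boundary_sub _ cX)).
by move=> vX; apply: boundary_small_face; rewrite ?cards1 //; apply/set0Pn; exists v; rewrite inE.
Qed.

Lemma facets_AutC X p s : p \in AutC X -> (p @: s \in facets X) = (s \in facets X).
Proof.
move=> pX; have pI := imset_inj (@perm_inj _ p).
rewrite !inE; apply/maxsetP/maxsetP => -[]; rewrite AutC_mem // => sX smax; split=> //.
  move=> t tX st; apply: pI; apply: smax; rewrite ?AutC_mem //; exact: imsetS.
move=> t; rewrite -(imset_permKV p t) AutC_mem // => tX st.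
rewrite (smax _ tX) //; apply/subsetP => x xs.
have := subsetP st _ (imset_f p xs); by rewrite mem_imset //; apply: perm_inj.
Qed.

Lemma AutC_boundary d X p : vertices (boundary d X) = vertices X ->
  p \in AutC X -> p \in AutC (boundary d X).
Proof.
move=> vX pX; have sub s t : (p @: s \subset p @: t) = (s \subset t).
  apply/idP/idP => [|/imsetS->] // st; apply/subsetP => x xs.
  by have := subsetP st _ (imset_f p xs); rewrite mem_imset //; apply: perm_inj.
rewrite inE vX; apply/andP; split; first by move: pX; rewrite inE => /andP[].
apply/forall_inP => s; rewrite !inE => /exists_inP[t]; rewrite inE => /and3P[tX ct ft] st.
apply/exists_inP; exists (p @: t); last by rewrite sub.
rewrite inE AutC_mem // tX card_imset ?ct /=; last exact: perm_inj.
apply/eqP; rewrite -(eqP ft) -[RHS](card_imset _ (imset_inj (@perm_inj _ p))); congr #|pred_of_set _|.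
apply/setP => g; rewrite -(imset_permKV p g) (mem_imset _ _ (imset_inj (@perm_inj _ p))).
by rewrite [LHS]in_set [RHS]in_set sub facets_AutC.
Qed.

End Boundary.

(** * Recognising vertices by the sizes of stars *)

Lemma uniq_map_inj (T1 T2 : eqType) (f : T1 -> T2) (s : seq T1) :
  uniq (map f s) -> {in s &, injective f}.
Proof.
elim: s => //= x s IH /andP[fx /IH inj] y z; rewrite !inE.
case/predU1P=> [->|ys] /predU1P[->|zs] // e; last exact: inj.
  by rewrite e map_f in fx.
by rewrite -e map_f in fx.
Qed.

Section Rigidity.
Variable T : finType.
Implicit Types (ws : seq (seq T)) (s : seq T) (p : {perm T}) (X : {set {set T}}).

Definition star_size ws s := size (undup (flatten [seq w <- ws | all (mem w) s])).

Definition preserves_small_faces n X p :=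
  forall u : {set T}, u != set0 -> #|u| <= n -> (p @: u \in X) = (u \in X).

(** The star of s is described by faces with one vertex more than s: it is an
    invariant of any map that preserves the faces of that size. *)
Lemma star_sizeE ws s : star_size ws s = #|[set v | [set:: v :: s] \in span ws]|.
Proof.
rewrite /star_size -(card_uniqP (undup_uniq _)); apply: eq_card => v.
rewrite mem_undup !inE; apply/flattenP/hasP => [[w]|[w wws]].
  rewrite mem_filter => /andP[/allP sw wws] vw; exists w => //.
  by apply/subsetP => x; rewrite !inE => /orP[/eqP->|/sw].
move=> sub; exists w; last by have := subsetP sub v; rewrite !inE eqxx => /(_ isT).
rewrite mem_filter wws andbT; apply/allP => x xs.
by have := subsetP sub x; rewrite !inE xs orbT => /(_ isT).
Qed.

Lemma star_size_map n ws p s : preserves_small_faces n (span ws) p -> size s < n ->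
  star_size ws (map p s) = star_size ws s.
Proof.
move=> pX sn; rewrite !star_sizeE -[RHS](card_imset _ (@perm_inj _ p)).
apply: eq_card => v; rewrite -[v](permKV p) (mem_imset _ _ (@perm_inj _ p)).
move: ((p^-1)%g v) => {}v.
have e : [set:: p v :: map p s] = p @: [set:: v :: s].
  apply/setP => x; rewrite -[x](permKV p) (mem_imset _ _ (@perm_inj _ p)) !inE.
  by rewrite (inj_eq perm_inj) mem_map //; apply: perm_inj.
rewrite in_set [RHS]in_set e pX //.
- by apply/set0Pn; exists v; rewrite !inE eqxx.
by rewrite cardsE (leq_trans (card_size _)).
Qed.

(** Allowing y = z covers the pairs as well as the triples that contain x. *)
Definition fingerprint ws b x := [seq star_size ws [:: y; z; x] | y <- b, z <- b].

Lemma fingerprint_map ws p b x : preserves_small_faces 4 (span ws) p ->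
  fingerprint ws (map p b) (p x) = fingerprint ws b x.
Proof.
move=> pX; rewrite /fingerprint allpairs_mapl allpairs_mapr.
by apply: eq_allpairs => y z; apply: (star_size_map (s := [:: y; z; x]) pX).
Qed.

(** The base is [rcons b x0], with x0 last because it is placed first, before
    any fingerprint is available: its image is restricted by a rotation only.
    The other images are found by a search that keeps, at each stage, all those
    with the right fingerprint relative to the images chosen before. *)
Fixpoint base_images ws vs reps x0 b :=
  if b is x :: b' then
    let c := fingerprint ws (rcons b' x0) x in
    [seq y :: ys | ys <- base_images ws vs reps x0 b',
                   y <- [seq y <- vs | fingerprint ws ys y == c]]
  else [seq [:: r] | r <- reps].

Definition rigid_base ws vs reps x0 b :=
  (base_images ws vs reps x0 b == [:: rcons b x0]) &&
  uniq [seq fingerprint ws (rcons b x0) x | x <- vs].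

Lemma base_imagesP ws vs reps x0 b p : (forall v, v \in vs) ->
  preserves_small_faces 4 (span ws) p -> p x0 \in reps ->
  map p (rcons b x0) \in base_images ws vs reps x0 b.
Proof.
move=> vsT pX px0; elim: b => [|x b IH] /=; first by rewrite map_f.
apply/allpairsPdep; exists (map p (rcons b x0)), (p x).
by split=> //; rewrite mem_filter vsT fingerprint_map ?eqxx.
Qed.

(** The base is fixed because it is its only possible image; then x and p x
    have the same fingerprint with respect to it, and fingerprints are
    pairwise different. *)
Lemma rigid_baseP ws vs reps x0 b p : (forall v, v \in vs) ->
  rigid_base ws vs reps x0 b ->
  preserves_small_faces 4 (span ws) p -> p x0 \in reps -> p = 1%g.
Proof.
move=> vsT /andP[/eqP one un] pX px0.
have := base_imagesP b vsT pX px0; rewrite one inE => /eqP fixb.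
apply/permP => x; rewrite perm1.
have e := fingerprint_map (rcons b x0) x pX; rewrite fixb in e.
exact: (uniq_map_inj un) (vsT _) (vsT x) e.
Qed.

End Rigidity.

(** * Complexes with a cyclic symmetry *)

Section CyclicComplexes.
Variables k m : nat.
Local Notation T := (vert k.+1 m).
Implicit Types (basic ws : seq (seq T)) (w b : seq T) (x : T) (i : 'Z_m).

Definition translate i x : T := shift x i.

(** Unlike [enum], this enumeration evaluates to an explicit list. *)
Definition ord_seq n : seq 'I_n.+1 := [seq inZp j | j <- iota 0 n.+1].

Lemma mem_ord_seq n (i : 'I_n.+1) : i \in ord_seq n.
Proof. by apply/mapP; exists (val i); rewrite ?valZpK // mem_iota /=. Qed.

Definition all_verts : seq T := [seq (l, i) | l <- ord_seq k, i : 'Z_m <- ord_seq _].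

Lemma mem_all_verts x : x \in all_verts.
Proof. by case: x => l i; apply/allpairs_f; apply: mem_ord_seq. Qed.

Definition orbit_reps : seq T := [seq (l, 0%R) | l <- ord_seq k].

Lemma mem_orbit_reps x : x.2 = 0%R -> x \in orbit_reps.
Proof. by case: x => l i /= ->; apply: map_f; apply: mem_ord_seq. Qed.

Definition rotations basic : seq (seq T) :=
  [seq map (translate i) w | i : 'Z_m <- ord_seq _, w <- basic].

Lemma cyclic_complexE basic : cyclic_complex basic = span (rotations basic).
Proof.
apply/setP => s; rewrite !inE; apply/exists_inP/hasP => [[f]|[w]].
  rewrite (big_morph (fun A : {set {set T}} => f \in A) (id1 := false) (op1 := orb)); last 2 first.
  - by move=> A B; rewrite inE.
  - by rewrite inE.
  rewrite big_has => /hasP[w wb /orbitP[i _ <-]] sf.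
  exists (map (translate i) w); first by apply: allpairs_f; rewrite ?mem_ord_seq.
  apply/subsetP => x /(subsetP sf) /imsetP[y]; rewrite !inE => yw ->.
  exact: map_f.
case/allpairsP => -[i w'] /= [_ wb ->] sw.
exists (setact (shift_action k.+1 m) [set:: w'] i).
  rewrite (big_morph (fun A : {set {set T}} => _ \in A) (id1 := false) (op1 := orb)); last 2 first.
  - by move=> A B; rewrite inE.
  - by rewrite inE.
  by rewrite big_has; apply/hasP; exists w' => //; apply/orbitP; exists i; rewrite ?inE.
apply/subsetP => x /(subsetP sw); rewrite inE => /mapP[y yw ->].
by apply/imsetP; exists y; rewrite ?inE.
Qed.

Definition rot i : {perm T} := actperm (shift_action k.+1 m) i.

Lemma rotE i x : rot i x = (x.1, (i + x.2)%R).
Proof. exact: actpermE. Qed.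

Definition all_families basic := all (mem [seq x.1 | x <- flatten basic]) (ord_seq k).

Lemma cyclic_vertices basic : all_families basic -> vertices (cyclic_complex basic) = setT.
Proof.
move=> /allP fam; apply/setP => -[l j]; rewrite cyclic_complexE !inE.
have /mapP[[l' j'] /flattenP[w wb xw] /= ->] := fam l (mem_ord_seq l).
apply/hasP; exists (map (translate (j - j')%R) w).
  by apply: allpairs_f; rewrite ?mem_ord_seq.
rewrite sub1set inE; apply/mapP; exists (l', j') => //.
by rewrite /translate /shift /= GRing.subrK.
Qed.

Lemma rot_AutC basic i : all_families basic -> rot i \in AutC (cyclic_complex basic).
Proof.
move=> fam; rewrite inE cyclic_vertices //; apply/andP; split.
  by apply/subsetP => x _; rewrite inE.
apply/forall_inP => s; rewrite cyclic_complexE !inE => /hasP[_ /allpairsP[[j w] /= [_ wb ->]] sw].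
apply/hasP; exists (map (translate (i + j)%R) w).
  by apply: allpairs_f; rewrite ?mem_ord_seq.
apply/subsetP => z /imsetP[x /(subsetP sw)]; rewrite inE => /mapP[y yw ->] ->.
by rewrite inE; apply/mapP; exists y => //; rewrite rotE /translate /shift /= GRing.addrA.
Qed.

Lemma facet_words_rotations d basic : facet_words d basic -> facet_words d (rotations basic).
Proof.
move=> /allP wd; apply/allP => _ /allpairsP[[i w] /= [_ /wd /andP[wu ws] ->]].
rewrite size_map ws andbT map_inj_uniq //.
by move=> x y e; apply: (@perm_inj _ (rot i)); rewrite !rotE.
Qed.

(** Every automorphism can be rotated so that it sends x0 to index 0, so rigidity
    of those that already do so is enough. *)
Lemma Aut_is_shift_of_rigid X x0 :
  (forall i, rot i \in AutC X) ->
  (forall p, p \in AutC X -> (p x0).2 = 0%R -> p = 1%g) ->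
  Aut_is_shift X.
Proof.
move=> rotX rigid; apply/isomP; split.
  apply/injmP => i j _ _ e.
  have {e}e : rot i (ord0, 0%R) = rot j (ord0, 0%R) by rewrite /rot e.
  by have := congr1 snd e; rewrite !rotE /= !GRing.addr0.
apply/setP => p; apply/morphimP/idP => [[i _ _ ->]|pX]; first exact: rotX.
set c := (p x0).2; have /rigid : (p * rot (- c)%R)%g \in AutC X by rewrite groupM.
rewrite permM rotE GRing.addNr => /(_ erefl) pc.
exists c; rewrite ?inE //; apply: (mulIg (rot (- c)%R)); rewrite pc.
apply/permP => -[l j]; rewrite permM perm1 !rotE.
by congr (_, _); rewrite GRing.addrA GRing.addNr GRing.add0r.
Qed.

Definition certificate d basic x0 b :=
  let ws := rotations basic in
  [&& facet_words d basic, all_families basic, all (stacked_link ws) orbit_reps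
    & rigid_base ws all_verts orbit_reps x0 b].

(** The bound 4 <= d is what the fingerprints require: they depend on the faces
    with at most 4 vertices, which must lie in the boundary. *)
Theorem cyclic_certificate d basic x0 b : 4 <= d ->
  certificate d.+1 basic x0 b ->
  let X := cyclic_complex basic in
  [/\ Kbar d.+1 X, Aut_is_shift X & Aut_is_shift (boundary d.+1 X)].
Proof.
move=> d4 /and4P[wd fam lk rigid] X.
have eX : X = span (rotations basic) := cyclic_complexE basic.
have ws0 : rotations basic != [::] by case: (rotations _) lk.
have wsd := facet_words_rotations wd.
have pX : pure d.+1 X by rewrite eX; apply: span_pure.
have cX : is_complex X by case/andP: pX.
have rotX i : rot i \in AutC X by apply: rot_AutC.
have kX : Kbar d.+1 X.
  rewrite eX; apply: Kbar_span lk => // v; rewrite -eX.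
  exists (rot (- v.2)%R) => //; rewrite mem_orbit_reps // rotE.
  exact: GRing.addNr.
have vX : vertices (boundary d.+1 X) = vertices X.
  by case: d {wd lk wsd} d4 pX kX => // d _; apply: boundary_vertices.
split=> //.
  apply: (@Aut_is_shift_of_rigid _ x0) => // p pA px0.
  apply: rigid_baseP rigid _ (mem_orbit_reps px0); first exact: mem_all_verts.
  by move=> u _ _; rewrite -eX AutC_mem.
apply: (@Aut_is_shift_of_rigid _ x0) => [i|p pA px0]; first exact: AutC_boundary.
apply: rigid_baseP rigid _ (mem_orbit_reps px0); first exact: mem_all_verts.
have small u : u != set0 -> #|u| <= 4 -> (u \in boundary d.+1 X) = (u \in X).
  move=> u0 u4; apply/idP/idP; first exact: (subsetP (boundary_sub _ cX)).
  by move=> uX; apply: boundary_small_face; rewrite // (leq_trans u4).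
move=> u u0 u4; rewrite -eX -!small ?AutC_mem //.
  by rewrite imset_eq0.
by rewrite card_imset //; apply: perm_inj.
Qed.

End CyclicComplexes.

(** * The four complexes *)

(** A rigid base has at least three vertices in each of the four complexes; the
    triples chosen here are not the only ones. *)
Lemma A21_certified : [/\ Kbar 5 A21, Aut_is_shift A21 & Aut_is_shift M21].
Proof.
apply: (@cyclic_certificate 2 7 4 _ (vc 0 7 0) [:: vc 0 7 6; vb 1 7 6] isT).
by vm_compute.
Qed.

Lemma B21_certified : [/\ Kbar 5 B21, Aut_is_shift B21 & Aut_is_shift N21].
Proof.
apply: (@cyclic_certificate 2 7 4 _ (vc 0 7 0) [:: vc 0 7 4; vb 1 7 6] isT).
by vm_compute.
Qed.

Lemma B26_certified : [/\ Kbar 5 B26, Aut_is_shift B26 & Aut_is_shift N26].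
Proof.
apply: (@cyclic_certificate 1 13 4 _ (vb 0 13 0) [:: vb 0 13 8; va 1 13 11] isT).
by vm_compute.
Qed.

Lemma A41_certified : [/\ Kbar 5 A41, Aut_is_shift A41 & Aut_is_shift M41].
Proof.
apply: (@cyclic_certificate 0 41 4 _ (va 0 41 0) [:: va 0 41 40; va 0 41 37] isT).
by vm_compute.
Qed.

Theorem lemma4p2 :
  [/\ [/\ Kbar 5 A21, Kbar 5 B21, Kbar 5 B26 & Kbar 5 A41],
      [/\ Aut_is_shift A21, Aut_is_shift M21, Aut_is_shift B21 & Aut_is_shift N21],
      Aut_is_shift B26 /\ Aut_is_shift N26
    & Aut_is_shift A41 /\ Aut_is_shift M41].
Proof.
have [kA21 aA21 aM21] := A21_certified.
have [kB21 aB21 aN21] := B21_certified.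
have [kB26 aB26 aN26] := B26_certified.
have [kA41 aA41 aM41] := A41_certified.
by split.
Qed.
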